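(* For all integers $n,\alpha,\beta\ge0$ and $r,s\in\mathbb{Z}$, $${n-\beta\choose\alpha}_r+{n-\alpha\choose\beta}_s={n\choose\alpha+\beta}_{r+s}+\sum_{k=0}^{n}\ \sum_{\substack{\ell,m\ge0\\ \ell+m=k-1}}{n\choose k}_{r+s}{\ell\choose\alpha}_r{m\choose\beta}_s.$$
   Context: The Euler polynomials $E_n(x)$ are defined by $\frac{2e^{xt}}{e^t+1}=\sum_{n\ge0}E_n(x)\frac{t^n}{n!}$. For integers $N\ge0$, define ${N\brack j}$ by $\sum_{j=1}^N{N\brack j}x^{2j-1}=x^{2N}-E_{2N}(x)$ and ${N\brace j}$ by $\sum_{j=0}^N{N\brace j}x^{2j}=x^{2N+1}-E_{2N+1}(x)$; set ${N\brack j}=0$ if $j\le0$ or $j>N$, ${N\brace j}=0$ if $j<0$ or $j>N$. For $r\in\mathbb{Z}$ and integers $0\le i\le n$ define $${n\choose i}_r:=\begin{cases}{r/2+n\brack r/2+i}, & r\text{ even},\ n\ge\max\{0,-r/2\},\\ -{-r/2-i\brack -r/2-n}, & r\text{ even},\ 0\le n<-r/2,\\ {(r-1)/2+n\brace (r-1)/2+i}, & r\text{ odd},\ n\ge\max\{0,-(r-1)/2\},\\ -{-(r+1)/2-i\brace -(r+1)/2-n}, & r\text{ odd},\ 0\le n<-(r-1)/2,\end{cases}$$ and set ${n\choose i}_r:=0$ whenever $n<0$, $i<0$ or $i>n$. (Equivalently, for $0\le i\le n$, ${n\choose i}_r=f_{n-i+1}\binom{r+2n}{r+2i-1}$ if $n\ge\max\{0,\lceil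 -r/2\rceil\}$ and $-f_{n-i+1}\binom{-r-2i}{-r-2n-1}$ if $0\le n<\lceil -r/2\rceil$, where $f_m=\frac{4^m-1}{m}B_{2m}$ and $B_j$ are the Bernoulli numbers.) *)

(* Defs.v *)
From HB Require Import structures.
From mathcomp Require Import all_boot all_order all_algebra.
Set Implicit Arguments. Unset Strict Implicit. Unset Printing Implicit Defensive.
Import Order.TTheory GRing.Theory Num.Theory.
Local Open Scope ring_scope.

(* Euler polynomials E_n(x) over rat.  Comparing coefficients of t^n in
   2 e^{xt} = (e^t + 1) * sum_n E_n(x) t^n/n!  gives
   2 x^n = E_n(x) + sum_{k<=n} C(n,k) E_k(x), i.e.
   E_n(x) = x^n - 1/2 * sum_{k<n} C(n,k) E_k(x).
   euler_seq n = [:: E_0; ...; E_n]. *)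
Fixpoint euler_seq (n : nat) : seq {poly rat} :=
  match n with
  | 0 => [:: 1]
  | n'.+1 =>
      let s := euler_seq n' in
      rcons s ('X^n - 2^-1 *: \sum_(k < n) ('C(n, k))%:R *: nth 0 s k)
  end.

Definition euler (n : nat) : {poly rat} := nth 0 (euler_seq n) n.

Definition ebrack (N j : int) : rat :=
  if (0 <= N) && (1 <= j) && (j <= N) then
    ('X^(2 * `|N|%N) - euler (2 * `|N|%N))`_(2 * `|j|%N - 1)
  else 0.

Definition ebrace (N j : int) : rat :=
  if (0 <= N) && (0 <= j) && (j <= N) then
    ('X^((2 * `|N|%N).+1) - euler ((2 * `|N|%N).+1))`_(2 * `|j|%N)
  else 0.

(* the r-binomial  (n choose i)_r ; h = floor(r/2), so h = r/2 for r even
   and h = (r-1)/2 for r odd (then -(r+1)/2 = -h-1). *)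
Definition rbinom (r n i : int) : rat :=
  if (n < 0) || (i < 0) || (n < i) then 0 else
  let h := (r %/ 2)%Z in
  if (r %% 2)%Z == 0 then
    (if Num.max 0 (- h) <= n then ebrack (h + n) (h + i)
     else - ebrack (- h - i) (- h - n))
  else
    (if Num.max 0 (- h) <= n then ebrace (h + n) (h + i)
     else - ebrace (- h - 1 - i) (- h - 1 - n)).

(* Main.v *)
Require Import Defs.
From HB Require Import structures.
From mathcomp Require Import all_boot all_order all_algebra.
From mathcomp Require Import ring zify.
Set Implicit Arguments.
Unset Strict Implicit.
Unset Printing Implicit Defensive.
Import Order.TTheory GRing.Theory Num.Theory.
Local Open Scope ring_scope.

(** Write tanh(t/2) = sum_k T_k t^k, an odd series, and let (u)_k denote the
    rising factorial.  Since x^n - E_n(x) = tanh(D/2) x^n, all four cases of the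
    definition give the single formula (n choose i)_r = T_k (r + 2i)_k, where
    k = 2(n-i) + 1 and i <= n.  The linear form x^i y^j |-> (u)_i (v)_j maps
    x^i y^j (x + y)^k to (u)_i (v)_j (u + v + i + j)_k (Vandermonde).  Applied with
    u = r + 2 alpha and v = s + 2 beta to the homogeneous components of
    tanh x + tanh y = tanh (x + y) (1 + tanh x tanh y), it yields the theorem. *)

Lemma natr_fact_neq0 (R : numDomainType) n : n`!%:R != 0 :> R.
Proof. by rewrite pnatr_eq0 -lt0n fact_gt0. Qed.

Lemma natr_bin (F : numFieldType) n k : (k <= n)%N ->
  'C(n, k)%:R = n`!%:R / (k`!%:R * (n - k)`!%:R) :> F.
Proof.
by move=> kn; rewrite -(bin_fact kn) !natrM mulfK // mulf_neq0 ?natr_fact_neq0.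
Qed.

Lemma dvdXn_subP (R : idomainType) M (p q : {poly R}) :
  reflect (forall k, (k < M)%N -> p`_k = q`_k) ('X^M %| p - q).
Proof.
rewrite /dvdp -Pdiv.IdomainMonic.take_poly_modp.
apply: (iffP eqP) => [pq k kM | pq].
  have := congr1 (fun f : {poly R} => f`_k) pq.
  by rewrite coef_take_poly kM coefB coef0 => /subr0_eq.
apply/polyP => k; rewrite coef_take_poly coef0 coefB.
by case: ifP => // /pq ->; rewrite subrr.
Qed.

Lemma horner_inj (R : numDomainType) (p q : {poly R}) :
  (forall x, p.[x] = q.[x]) -> p = q.
Proof.
move=> pq; apply/eqP; rewrite -subr_eq0; apply/eqP.
apply: (@roots_geq_poly_eq0 _ _ [seq n%:R | n <- iota 0 (size (p - q))]).
- by apply/allP => x _; rewrite /root !hornerE pq subrr.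
- by rewrite map_inj_uniq ?iota_uniq //; apply: mulrIn; apply: oner_neq0.
- by rewrite size_map size_iota.
Qed.

Lemma big_ord_double (V : nmodType) (F : nat -> V) n :
  \sum_(i < n.*2) F i = \sum_(i < n) (F i.*2 + F i.*2.+1).
Proof.
elim: n => [|n IHn]; first by rewrite !big_ord0.
by rewrite doubleS !big_ord_recr /= IHn addrA.
Qed.

Lemma sum_odd_triples (V : nmodType) (F : nat -> nat -> nat -> V) d :
    (forall i j k, ~~ [&& odd i, odd j & odd k] -> F i j k = 0) ->
  \sum_(m < d.*2.+2) \sum_(i < m.+1) F i (m - i)%N (d.*2.+1 - m)%N =
  \sum_(c < d) \sum_(i < c.+1) F i.*2.+1 (c - i).*2.+1 (d.-1 - c).*2.+1.
Proof.
move=> F0; rewrite -doubleS.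
rewrite (big_ord_double (fun m => \sum_(i < m.+1) F i (m - i)%N (d.*2.+1 - m)%N)).
rewrite big_ord_recl big_ord1 F0 // big1 => [|i _]; last by rewrite F0 //=; lia.
rewrite !add0r; apply: eq_bigr => c _; have cd := ltn_ord c.
rewrite lift0 [X in _ + X]big1 ?addr0 => [|i _]; last by rewrite F0 //=; lia.
rewrite big_ord_recr /= F0 ?addr0; last by lia.
rewrite (big_ord_double (fun i => F i (c.+1.*2 - i)%N (d.*2.+1 - c.+1.*2)%N)).
apply: eq_bigr => i _; have ic := ltn_ord i.
by rewrite F0 ?add0r ?odd_double //; congr F; lia.
Qed.

Lemma sum_convolution_support (V : nmodType) (F : nat -> nat -> nat -> V) n a b :
    (forall k l m, (l < a)%N || (m < b)%N -> F k l m = 0) ->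
  \sum_(k < n.+1) \sum_(l < k) F k l (k - 1 - l)%N =
  \sum_(c < n - (a + b)) \sum_(i < c.+1) F (a + b + c.+1)%N (a + i)%N (b + (c - i))%N.
Proof.
move=> F0; have [n_lt|ab_le] := ltnP n (a + b).
  rewrite (eqP (ltnW n_lt)) big_ord0 big1 // => k _; rewrite big1 // => l _.
  by rewrite F0 //; have := ltn_ord k; have := ltn_ord l; lia.
rewrite -[in LHS](subnKC ab_le) -addSn big_split_ord /=.
rewrite big1 ?add0r => [|k _]; last first.
  by rewrite big1 // => l _; rewrite F0 //; have := ltn_ord k; have := ltn_ord l; lia.
apply: eq_bigr => c _.
have -> : ((a + b).+1 + c)%N = (a + (c.+1 + b))%N by lia.
rewrite !big_split_ord /= big1 ?add0r => [|l _]; last by rewrite F0 ?ltn_ord.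
rewrite [X in _ + X]big1 ?addr0 => [|l _]; last first.
  by rewrite F0 //; have := ltn_ord l; lia.
by apply: eq_bigr => i _; have ic := ltn_ord i; congr F; lia.
Qed.

Definition rising {R : nzRingType} (u : R) (k : nat) : R := \prod_(j < k) (u + j%:R).

Lemma rising0 (R : nzRingType) (u : R) : rising u 0 = 1.
Proof. exact: big_ord0. Qed.

Lemma risingSr (R : nzRingType) (u : R) k :
  rising u k.+1 = rising u k * (u + k%:R).
Proof. exact: big_ord_recr. Qed.

Lemma risingSl (R : nzRingType) (u : R) k :
  rising u k.+1 = u * rising (u + 1) k.
Proof.
rewrite /rising big_ord_recl addr0; congr (_ * _).
by apply: eq_bigr => j _; rewrite -addrA nat1r.
Qed.

Lemma rising_ffact (R : comNzRingType) n k :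
  rising (n%:R - k%:R + 1 : R) k = (n ^_ k)%:R.
Proof.
elim: k => [|k IHk]; first by rewrite rising0 ffactn0.
rewrite risingSl -[k.+1]addn1 natrD opprD addrA subrK IHk addn1 ffactnSr mulrC.
case: (leqP k n) => [kn|nk]; first by rewrite natrM natrB.
by rewrite ffact_small // mul0r mul0n.
Qed.

Lemma rising_opp_ffact (R : comNzRingType) n k :
  rising (- n%:R : R) k = (-1) ^+ k * (n ^_ k)%:R.
Proof.
elim: k => [|k IHk]; first by rewrite rising0 ffactn0 mul1r.
rewrite risingSr IHk ffactnSr exprSr natrM.
case: (leqP k n) => [kn|nk]; first by rewrite natrB //; ring.
by rewrite ffact_small // !(mulr0, mul0r).
Qed.

Section RisingForm.

Variables (R : comNzRingType) (u v : R).

(* The polynomial p stands for the binary form y^N p(x/y) of degree N, on which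
   this is the linear form x^i y^j |-> (u)_i (v)_j. *)
Definition rising_form (N : nat) (p : {poly R}) : R :=
  \sum_(j < N.+1) p`_j * (rising u j * rising v (N - j)).

Lemma rising_form_is_scalar N : scalar (rising_form N).
Proof.
move=> a p q; rewrite /rising_form mulr_sumr -big_split; apply: eq_bigr => j _ /=.
by rewrite coefD coefZ mulrDl mulrA.
Qed.

HB.instance Definition _ N := GRing.isLinear.Build R {poly R} R *%R
  (rising_form N) (rising_form_is_scalar N).

Lemma rising_formXn i j : rising_form (i + j) 'X^i = rising u i * rising v j.
Proof.
have ilt : (i < (i + j).+1)%N by rewrite ltnS leq_addr.
rewrite /rising_form (bigD1 (Ordinal ilt)) //= coefXn eqxx mul1r addKn.
rewrite big1 ?addr0 // => k; rewrite -val_eqE /= coefXn => /negPf->.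
by rewrite mul0r.
Qed.

Lemma rising_formXnD1 i j k :
  rising_form (i + j + k) ('X^i * ('X + 1) ^+ k) =
  rising u i * rising v j * rising (u + v + (i + j)%:R) k.
Proof.
elim: k i j => [|k IHk] i j.
  by rewrite addn0 expr0 rising0 !mulr1 rising_formXn.
have -> : 'X^i * ('X + 1) ^+ k.+1 =
    'X^(i.+1) * ('X + 1) ^+ k + 'X^i * ('X + 1) ^+ k :> {poly R}.
  by rewrite !exprS; ring.
have Si : (i + j + k.+1 = i.+1 + j + k)%N by lia.
have Sj : (i + j + k.+1 = i + j.+1 + k)%N by lia.
rewrite linearD /= {1}Si Sj !IHk (risingSr u) (risingSr v) risingSl.
by rewrite addSn addnS -[_ + _ + 1]addrA natr1 natrD; ring.
Qed.

End RisingForm.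

Lemma size_euler_seq n : size (euler_seq n) = n.+1.
Proof. by elim: n => //= n IHn; rewrite size_rcons IHn. Qed.

Lemma nth_euler_seq n k : (k <= n)%N -> nth 0 (euler_seq n) k = euler k.
Proof.
elim: n => [|n IHn]; first by rewrite leqn0 => /eqP->.
rewrite leq_eqVlt => /predU1P[-> //|kn].
by rewrite -IHn //= nth_rcons size_euler_seq kn.
Qed.

Lemma eulerE n :
  euler n = 'X^n - 2^-1 *: \sum_(k < n) 'C(n, k)%:R *: euler k.
Proof.
case: n => [|n]; first by rewrite big_ord0 scaler0 subr0.
rewrite {1}/euler /= nth_rcons size_euler_seq ltnn eqxx.
by congr (_ - _ *: _); apply: eq_bigr => k _; rewrite nth_euler_seq // -ltnS.
Qed.

Lemma size_euler n : (size (euler n) <= n.+1)%N.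
Proof.
elim/ltn_ind: n => n IHn; rewrite eulerE.
apply: leq_trans (size_polyD _ _) _; rewrite size_polyXn geq_max leqnn size_polyN.
apply: leq_trans (size_scale_leq _ _) _; apply: leq_trans (size_sum _ _ _) _.
apply/bigmax_leqP => k _; apply: leq_trans (size_scale_leq _ _) _.
exact: leq_trans (IHn k _) (leqW _).
Qed.

(* The Taylor coefficients of 2/(e^t + 1). *)
Definition euler_taylor (k : nat) : rat := (euler k)`_0 / k`!%:R.

Lemma euler_taylorE n :
  euler_taylor n = (n == 0%N)%:R - 2^-1 * \sum_(k < n) euler_taylor k / (n - k)`!%:R.
Proof.
have f0 := @natr_fact_neq0 rat.
rewrite /euler_taylor eulerE coefB coefXn coefZ coef_sum mulrBl eq_sym.
congr (_ - _); first by case: n => [|n]; rewrite ?divr1 ?mul0r.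
rewrite -mulrA mulr_suml; congr (_ * _); apply: eq_bigr => k _.
by rewrite coefZ natr_bin 1?ltnW //; field; rewrite !f0.
Qed.

Lemma coef_euler j d :
  (euler (j + d))`_j = (j + d)`!%:R / j`!%:R * euler_taylor d.
Proof.
have f0 := @natr_fact_neq0 rat.
elim/ltn_ind: d => d IHd.
rewrite eulerE coefB coefXn coefZ coef_sum big_split_ord /= big1 ?add0r => [|k _].
  rewrite euler_taylorE mulrBr mulrCA [in RHS]mulr_sumr -{1}[j]addn0 eqn_add2l eq_sym.
  congr (_ - _); first by case: d {IHd} => [|d]; rewrite ?mulr0 // addn0 divff ?mulr1.
  congr (_ * _); apply: eq_bigr => k _.
  rewrite coefZ IHd // natr_bin ?leq_add2l ?subnDl 1?ltnW //.
  by field; rewrite !f0.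
by rewrite coefZ nth_default ?mulr0 // (leq_trans (size_euler k)).
Qed.

(* tanh(t/2) = 1 - 2/(e^t + 1). *)
Definition tanh_taylor (k : nat) : rat := (k == 0%N)%:R - euler_taylor k.

Lemma tanh_taylor0 : tanh_taylor 0 = 0.
Proof. by rewrite /tanh_taylor euler_taylorE big_ord0 mulr0 subr0 subrr. Qed.

Lemma coef_Xn_sub_euler n k : (k <= n)%N ->
  ('X^n - euler n)`_(n - k) = tanh_taylor k * (n ^_ k)%:R.
Proof.
move=> kn; rewrite coefB coefXn -{3}(subnK kn) coef_euler subnK //.
rewrite -(ffact_fact kn) natrM mulfK ?natr_fact_neq0 // mulrBl [(_ ^_ _)%:R * _]mulrC.
congr (_ - _); case: k kn => [|k] kn; first by rewrite subn0 eqxx mulr1.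
by rewrite ltn_eqF ?mul0r //; lia.
Qed.

Definition exp_trunc {F : numFieldType} (M : nat) (x : F) : {poly F} :=
  \poly_(k < M) (x ^+ k / k`!%:R).

Definition tanh_trunc (M : nat) (x : rat) : {poly rat} :=
  \poly_(k < M) (tanh_taylor k * x ^+ k).

Lemma exp_trunc_add_mod (F : numFieldType) M (x y : F) :
  'X^M %| exp_trunc M x * exp_trunc M y - exp_trunc M (x + y).
Proof.
have f0 := @natr_fact_neq0 F.
apply/dvdXn_subP => k kM; rewrite coefM coef_poly kM addrC exprDn mulr_suml.
apply: eq_bigr => j _; have jk : (j <= k)%N by rewrite -ltnS.
rewrite !coef_poly (leq_ltn_trans jk kM) (leq_ltn_trans (leq_subr _ _) kM).
by rewrite -[in RHS]mulr_natr natr_bin //; field; rewrite !f0.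
Qed.

Lemma tanh_exp_trunc_mod M x :
  'X^M %| (1 - tanh_trunc M x) * (exp_trunc M x + 1) - 2%:R.
Proof.
have f0 := @natr_fact_neq0 rat.
have coef_1subT k : (k < M)%N -> (1 - tanh_trunc M x)`_k = euler_taylor k * x ^+ k.
  rewrite coefB coef1 coef_poly => ->; rewrite mulrBl opprB addrC addrAC -addrA.
  by case: k => [|k]; rewrite ?mul1r ?mul0r ?subrr ?addr0.
apply/dvdXn_subP => k kM; rewrite mulrDr mulr1 coefD coefM coef_1subT //.
have -> : \sum_(j < k.+1) (1 - tanh_trunc M x)`_j * (exp_trunc M x)`_(k - j) =
    x ^+ k * \sum_(j < k.+1) euler_taylor j / (k - j)`!%:R.
  rewrite mulr_sumr; apply: eq_bigr => j _; have jk : (j <= k)%N by rewrite -ltnS.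
  rewrite coef_1subT ?(leq_ltn_trans jk) // coef_poly (leq_ltn_trans (leq_subr _ _)) //.
  by rewrite -[in x ^+ k](subnKC jk) exprD; field; rewrite f0.
rewrite big_ord_recr /= subnn fact0 divr1 -polyC_natr coefC.
set S := \sum_(j < k) _.
have -> : S = 2 * ((k == 0%N)%:R - euler_taylor k) by rewrite euler_taylorE -/S; field.
by case: k {kM S} => [|k] /=; rewrite ?expr0; ring.
Qed.

(* With g := 1 - tanh(z/2) = 2/(e^z + 1), the addition law reads
   g_x g_y = g_xy (g_x g_y + (2 - g_x)(2 - g_y)) / 2, where 2 - g_z = g_z e^z. *)
Lemma tanh_add_mod (F : numFieldType) (m ex ey exy tx ty txy : {poly F}) :
    m %| ex * ey - exy ->
    m %| (1 - tx) * (ex + 1) - 2%:R -> m %| (1 - ty) * (ey + 1) - 2%:R ->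
    m %| (1 - txy) * (exy + 1) - 2%:R ->
  m %| txy * (1 + tx * ty) - (tx + ty).
Proof.
move=> exyE txE tyE txyE.
have two_neq0 : 2 != 0 :> F by rewrite pnatr_eq0.
rewrite -(dvdpZr _ _ two_neq0) -mul_polyC polyC_natr.
have -> : 2%:R * (txy * (1 + tx * ty) - (tx + ty)) =
    ((1 - tx) * (ex + 1) - 2%:R) * ((1 - txy) * (1 - ty) * ey)
    + ((1 - ty) * (ey + 1) - 2%:R) * ((1 - txy) * (1 + tx))
    - ((1 - txy) * (exy + 1) - 2%:R) * ((1 - tx) * (1 - ty))
    - (ex * ey - exy) * ((1 - tx) * (1 - ty) * (1 - txy)) by ring.
by rewrite !(dvdp_sub, dvdp_add) // dvdp_mulr.
Qed.

Lemma tanh_taylor_add n (x y : rat) :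
  tanh_taylor n * x ^+ n + tanh_taylor n * y ^+ n =
  tanh_taylor n * (x + y) ^+ n +
  \sum_(m < n.+1) \sum_(i < m.+1)
    tanh_taylor i * tanh_taylor (m - i) * tanh_taylor (n - m) *
    (x ^+ i * y ^+ (m - i) * (x + y) ^+ (n - m)).
Proof.
have := tanh_add_mod (exp_trunc_add_mod n.+1 x y)
  (tanh_exp_trunc_mod _ _) (tanh_exp_trunc_mod _ _) (tanh_exp_trunc_mod _ _).
move=> /dvdXn_subP/(_ n (ltnSn n)).
rewrite mulrDr mulr1 mulrC !coefD !coef_poly ltnSn => <-; congr (_ + _).
rewrite coefM; apply: eq_bigr => m _; have mn : (m <= n)%N by rewrite -ltnS.
rewrite coefM coef_poly ltnS leq_subr mulr_suml; apply: eq_bigr => i _.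
have im : (i <= m)%N by rewrite -ltnS.
rewrite !coef_poly !ltnS (leq_trans im mn) (leq_trans (leq_subr _ _) mn).
ring.
Qed.

Lemma tanh_taylor_even k : ~~ odd k -> tanh_taylor k = 0.
Proof.
move=> ek; have := tanh_taylor_add k 1 (-1).
rewrite subrr big1 ?addr0 => [|m _]; last first.
  rewrite big1 // => i _; rewrite expr0n; case: eqP => [->|_]; last by rewrite !mulr0.
  by rewrite tanh_taylor0 mulr0 mul0r.
rewrite expr1n -signr_odd (negPf ek) expr0 mulr1 expr0n.
case: eqP => [->|_]; first by rewrite tanh_taylor0.
by rewrite mulr0 => /eqP; rewrite -mulr2n mulrn_eq0 => /eqP.
Qed.

Lemma tanh_taylor_rising n (u v : rat) :
  tanh_taylor n * rising u n + tanh_taylor n * rising v n =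
  tanh_taylor n * rising (u + v) n +
  \sum_(m < n.+1) \sum_(i < m.+1)
    tanh_taylor i * tanh_taylor (m - i) * tanh_taylor (n - m) *
    (rising u i * rising v (m - i) * rising (u + v + m%:R) (n - m)).
Proof.
have /horner_inj addXD1 : forall x : rat,
    (tanh_taylor n *: 'X^n + tanh_taylor n *: 'X^0).[x] =
    (tanh_taylor n *: ('X^0 * ('X + 1) ^+ n) + \sum_(m < n.+1) \sum_(i < m.+1)
      (tanh_taylor i * tanh_taylor (m - i) * tanh_taylor (n - m)) *:
      ('X^i * ('X + 1) ^+ (n - m))).[x].
  move=> x; have := tanh_taylor_add n x 1.
  pose hornerXD1 := (hornerM, horner_exp, hornerXn, hornerD, hornerX, hornerC).
  rewrite expr1n !(hornerZ, hornerXD1) expr0 mul1r => ->; congr (_ + _).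
  rewrite horner_sum; apply: eq_bigr => m _; rewrite horner_sum; apply: eq_bigr => i _.
  by rewrite !(hornerZ, hornerXD1) expr1n mulr1.
have := congr1 (rising_form u v n) addXD1; rewrite !linearD !linearZ /=.
have := rising_formXn u v n 0; rewrite addn0 rising0 mulr1 => ->.
have := rising_formXn u v 0 n; rewrite add0n rising0 mul1r => ->.
have := rising_formXnD1 u v 0 0 n; rewrite !add0n !rising0 !mul1r addr0 => -> ->.
congr (_ + _); rewrite linear_sum; apply: eq_bigr => m _.
rewrite linear_sum; apply: eq_bigr => i _; rewrite linearZ /=; congr (_ * _).
have := rising_formXnD1 u v i (m - i) (n - m).
by rewrite !subnKC // -ltnS.
Qed.

Lemma tanh_taylor_rising_odd d (u v : rat) :
  tanh_taylor d.*2.+1 * rising u d.*2.+1 + tanh_taylor d.*2.+1 * rising v d.*2.+1 =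
  tanh_taylor d.*2.+1 * rising (u + v) d.*2.+1 +
  \sum_(c < d) \sum_(i < c.+1)
    tanh_taylor i.*2.+1 * tanh_taylor (c - i).*2.+1 * tanh_taylor (d.-1 - c).*2.+1 *
    (rising u i.*2.+1 * rising v (c - i).*2.+1
     * rising (u + v + c.+1.*2%:R) (d.-1 - c).*2.+1).
Proof.
pose F i j k := tanh_taylor i * tanh_taylor j * tanh_taylor k *
  (rising u i * rising v j * rising (u + v + (i + j)%:R) k).
rewrite tanh_taylor_rising; congr (_ + _).
transitivity (\sum_(m < d.*2.+2) \sum_(i < m.+1) F i (m - i)%N (d.*2.+1 - m)%N).
  by apply: eq_bigr => m _; apply: eq_bigr => i _; rewrite /F subnKC // -ltnS.
rewrite sum_odd_triples => [|i j k]; last first.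
  by rewrite /F !negb_and => /or3P[] /tanh_taylor_even->; rewrite !(mul0r, mulr0).
apply: eq_bigr => c _; apply: eq_bigr => i _; rewrite /F.
by congr (_ * (_ * rising (_ + _%:R) _)); have := ltn_ord i; lia.
Qed.

Lemma ebrackE (N m : nat) :
  ebrack N (N%:Z - m%:Z) = tanh_taylor m.*2.+1 * ((2 * N) ^_ m.*2.+1)%:R.
Proof.
rewrite /ebrack; case: ifPn => [mN|Nm].
  by rewrite -coef_Xn_sub_euler ?absz_nat; first congr (_`_ _); lia.
by rewrite ffact_small ?mulr0 //; lia.
Qed.

Lemma ebraceE (N m : nat) :
  ebrace N (N%:Z - m%:Z) = tanh_taylor m.*2.+1 * ((2 * N).+1 ^_ m.*2.+1)%:R.
Proof.
rewrite /ebrace; case: ifPn => [mN|Nm].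
  by rewrite -coef_Xn_sub_euler ?absz_nat; first congr (_`_ _); lia.
by rewrite ffact_small ?mulr0 //; lia.
Qed.

Lemma rbinom_small (r n i : int) : n < i -> rbinom r n i = 0.
Proof. by rewrite /rbinom => ->; rewrite orbT. Qed.

Lemma rbinom_ffact (r : int) (i m P : nat) : r + 2 * (i + m)%N%:Z = P ->
  rbinom r (i + m)%N i = tanh_taylor m.*2.+1 * (P ^_ m.*2.+1)%:R.
Proof.
move=> PE; rewrite /rbinom ifF; last by lia.
set h := (r %/ 2)%Z; have rE : r = h * 2 + (r %% 2)%Z := divz_eq r 2.
have r01 : 0 <= (r %% 2)%Z < 2 by rewrite modz_ge0 //= ltz_pmod.
case hN: (h + (i + m)%N) => [N|N]; last by lia.
have le_hn : Num.max 0 (- h) <= (i + m)%N%:Z by lia.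
have -> : h + i = N%:Z - m%:Z by lia.
rewrite le_hn ebrackE ebraceE.
by case: ifPn => r0; congr (_ * (_ ^_ _)%:R); lia.
Qed.

Lemma rbinom_opp_ffact (r : int) (i m Q : nat) :
    r + 2 * (i + m)%N%:Z < 0 -> - (r + 2 * i%:Z) = Q ->
  rbinom r (i + m)%N i = - (tanh_taylor m.*2.+1 * (Q ^_ m.*2.+1)%:R).
Proof.
move=> r_lt QE; rewrite /rbinom ifF; last by lia.
set h := (r %/ 2)%Z; have rE : r = h * 2 + (r %% 2)%Z := divz_eq r 2.
have r01 : 0 <= (r %% 2)%Z < 2 by rewrite modz_ge0 //= ltz_pmod.
have /negPf-> : ~~ (Num.max 0 (- h) <= (i + m)%N%:Z) by lia.
case: ifPn => r0.
- case hN: (- h - i%:Z) => [N|N]; last by lia.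
  have -> : - h - (i + m)%N%:Z = N%:Z - m%:Z by lia.
  by rewrite ebrackE; congr (- (_ * (_ ^_ _)%:R)); lia.
- case hN: (- h - 1 - i%:Z) => [N|N]; last by lia.
  have -> : - h - 1 - (i + m)%N%:Z = N%:Z - m%:Z by lia.
  by rewrite ebraceE; congr (- (_ * (_ ^_ _)%:R)); lia.
Qed.

Lemma rbinomE (r : int) (i m : nat) :
  rbinom r (i + m)%N i = tanh_taylor m.*2.+1 * rising (r%:~R + i.*2%:R) m.*2.+1.
Proof.
case: (lerP 0 (r + 2 * (i + m)%N%:Z)) => r_sgn.
- case PE: (r + 2 * (i + m)%N%:Z) => [P|P]; last by lia.
  rewrite (rbinom_ffact PE) -rising_ffact; congr (_ * rising _ _).
  have -> : r = P%:Z - 2 * (i + m)%N%:Z by rewrite -PE addrK.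
  by rewrite rmorphB rmorphM /= -!pmulrn -!mul2n; ring.
- case QE: (- (r + 2 * i%:Z)) => [Q|Q]; last by lia.
  rewrite (rbinom_opp_ffact r_sgn QE) -mulrN -mulN1r.
  have -> : r%:~R + i.*2%:R = - Q%:R :> rat.
    have -> : r = - Q%:Z - 2 * i%:Z by lia.
    by rewrite rmorphB rmorphM rmorphN /= -!pmulrn -!mul2n; ring.
  by rewrite rising_opp_ffact -signr_odd /= odd_double.
Qed.

Theorem theorem6p1 (n alpha beta : nat) (r s : int) :
  rbinom r (n%:Z - beta%:Z) alpha%:Z + rbinom s (n%:Z - alpha%:Z) beta%:Z =
  rbinom (r + s) n%:Z (alpha + beta)%N%:Z +
  \sum_(k < n.+1) \sum_(l < k)
     rbinom (r + s) n%:Z k%:Z * rbinom r l%:Z alpha%:Z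
       * rbinom s (k - 1 - l)%N%:Z beta%:Z.
Proof.
pose summand k l m : rat :=
  rbinom (r + s) n%:Z k%:Z * rbinom r l%:Z alpha%:Z * rbinom s m%:Z beta%:Z.
rewrite [X in _ = _ + X](@sum_convolution_support _ summand n alpha beta); last first.
  move=> k l m /orP[l_lt|m_lt]; rewrite /summand.
    by rewrite (@rbinom_small r) ?mulr0 ?mul0r.
  by rewrite (@rbinom_small s) ?mulr0.
have [n_lt|ab_le] := ltnP n (alpha + beta).
  by rewrite !rbinom_small ?(eqP (ltnW n_lt)) ?big_ord0 ?addr0 //; lia.
have [d nE] : exists d, n = (alpha + beta + d)%N by exists (n - (alpha + beta))%N; lia.
have -> : n%:Z - beta%:Z = (alpha + d)%N by lia.
have -> : n%:Z - alpha%:Z = (beta + d)%N by lia.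
have uvE k : (r + s)%:~R + (alpha + beta + k).*2%:R =
    r%:~R + alpha.*2%:R + (s%:~R + beta.*2%:R) + k.*2%:R :> rat.
  by rewrite rmorphD -!mul2n; ring.
have := uvE 0%N; rewrite addn0 addr0 /summand nE addKn !rbinomE => ->.
rewrite tanh_taylor_rising_odd; congr (_ + _).
apply: eq_bigr => c _; apply: eq_bigr => i _; have cd := ltn_ord c.
have -> : (alpha + beta + d = alpha + beta + c.+1 + (d.-1 - c))%N by lia.
by rewrite !rbinomE uvE; ring.
Qed.
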